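(* Let $R$ be a commutative ring with identity and $S$ a multiplicative subset of $R$ with $0\notin S$. The following are equivalent: (1) $R$ is an $S$-field. (2) There exists $s\in S$ such that every element $a\in R$ is either $S$-invertible or satisfies $sa=0$.
   Context: A multiplicative subset $S$ of $R$ is a subset containing $1$ and closed under multiplication. An element $a\in R$ is $S$-invertible if there exists $b\in R$ with $ab\in S$. An ideal $M$ of $R$ is $S$-maximal if $M\cap S=\emptyset$ and there exists a fixed $s\in S$ such that for every ideal $I$ of $R$ with $M\subseteq I$, either $sI\subseteq M$ or $I\cap S\neq\emptyset$. The ring $R$ is an $S$-field if the zero ideal $(0)$ is an $S$-maximal ideal. *)

(* Defs.v *)
From mathcomp Require Import all_boot all_algebra.
From mathcomp Require Import boolp classical_sets.

Set Implicit Arguments.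
Unset Strict Implicit.
Unset Printing Implicit Defensive.

Import GRing.Theory.

Local Open Scope classical_set_scope.
Local Open Scope ring_scope.

(* [mulr_closed] includes [1 \in S]. *)
Definition mult_subset (R : comPzRingType) (S : set R) : Prop :=
  GRing.mulr_closed (mem S).

(* Ideals are the submodules of the regular module [R^o]. MathComp's
   [idealr_closed] is not used because it only covers proper ideals. *)
Definition is_ideal (R : comPzRingType) (I : set R) : Prop :=
  GRing.submod_closed (mem (I : set R^o)).

Definition S_invertible (R : comPzRingType) (S : set R) (a : R) : Prop :=
  exists b : R, a * b \in S.

Definition S_maximal (R : comPzRingType) (S M : set R) : Prop :=
  [/\ is_ideal M, M `&` S = set0 &
      exists2 s : R, s \in S &
        forall I : set R, is_ideal I -> M `<=` I ->
          [set s * x | x in I] `<=` M \/ I `&` S !=set0].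

Definition S_field (R : comPzRingType) (S : set R) : Prop :=
  S_maximal S [set 0].

(* Main.v *)
Require Import Defs.
From mathcomp Require Import all_boot all_algebra.
From mathcomp Require Import boolp classical_sets.

Import GRing.Theory.

Local Open Scope classical_set_scope.
Local Open Scope ring_scope.

(** The same [s] serves both conditions. Testing maximality of zero on the principal ideal [aR]
    gives the element condition: [s(aR) = 0] forces [s * a = 0], while a point of [aR] in [S] is an
    S-inverse of [a]. Conversely, an ideal containing an S-invertible element meets [S] by
    absorption; any other ideal is killed by [s] element by element. *)

Lemma is_ideal0 (R : comPzRingType) : is_ideal [set 0 : R].
Proof.
split=> [|c u v]; rewrite !inE //= => -> ->.
by rewrite scaler0 addr0.
Qed.

Lemma is_ideal_principal (R : comPzRingType) (a : R) :
  is_ideal (range ( *%R a)).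
Proof.
split=> [|c u v]; rewrite !inE /=; first by exists 0; rewrite ?mulr0.
move=> [x _ <-] [y _ <-]; exists (c * x + y) => //.
by rewrite mulrDr mulrCA.
Qed.

Lemma is_ideal_mulr (R : comPzRingType) (I : set R) (a b : R) :
  is_ideal I -> I a -> I (a * b).
Proof.
move=> [I0 Ilin] /mem_set Ia; apply: set_mem.
(* Adding 0 matches the linear combination [c *: u + v] with [v = 0]; scaling in [R^o] is
   multiplication. *)
by rewrite mulrC -[b * a]addr0; apply: Ilin.
Qed.

Theorem proposition2p5 (R : comPzRingType) (S : set R)
    (S_mult : mult_subset S) (S_non0 : 0 \notin S) :
  S_field S <->
  exists2 s : R, s \in S & forall a : R, S_invertible S a \/ s * a = 0.
Proof.
split=> [[_ _ [s Ss maxS]] | [s Ss invS]].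
  exists s => // a.
  have aR0 : [set 0] `<=` range ( *%R a).
    by move=> _ ->; exists 0; rewrite ?mulr0.
  have [sub0|[_ [[b _ <-] Sab]]] := maxS _ (is_ideal_principal R a) aR0.
    by right; apply: sub0; exists a => //; exists 1; rewrite ?mulr1.
  by left; exists b; apply: mem_set.
split; first exact: is_ideal0.
  by apply/seteqP; split=> // _ [/= ->] /mem_set S0; rewrite S0 in S_non0.
exists s => // I idI _.
(* [invS] decides one element at a time; excluded middle turns this into one alternative for all of
   [I]. *)
have [[a Ia [b Sab]]|noinv] := pselect (exists2 a, I a & S_invertible S a).
  by right; exists (a * b); split; [exact: is_ideal_mulr | exact: set_mem].
left=> _ [a Ia <-]; case: (invS a) => // inva.
by case: noinv; exists a.
Qed.
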